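(* $\circledast^*(\omega_1,\omega_1,\omega)$ holds.
   Context: $[\omega_1]^{<\omega}$ is the set of finite subsets of $\omega_1$. $\circledast^*(\omega_1,\omega_1,\omega)$ asserts there is $d:[\omega_1]^{<\omega}\rightarrow\omega_1$ such that for every integer $n\ge2$, every sequence $\langle\mathcal X_i\mid i<n\rangle$ of uncountable subfamilies of $[\omega_1]^{<\omega}$, and every $\delta<\omega_1$, there is $\langle x_i\mid i<n\rangle$ with $x_i\in\mathcal X_i$, $\langle\sup(x_i)\mid i<n\rangle$ strictly increasing, and $d(z)=\delta$ whenever $\bigcup_{i<n}\big(x_i\setminus\bigcup_{j\ne i}x_j\big)\subseteq z\subseteq\bigcup_{i<n}x_i$. *)

(* Defs.v *)
From HB Require Import structures.
From mathcomp Require Import all_boot all_order finmap.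
From mathcomp Require Import boolp wochoice classical_sets functions cardinality.

Set Implicit Arguments.
Unset Strict Implicit.
Unset Printing Implicit Defensive.

Import Order.TTheory.
Local Open Scope order_scope.

(* ω_1 up to order isomorphism: an uncountable well-order all of whose proper
   initial segments are countable. The bottom element of T is the ordinal 0. *)
Definition is_omega1 (disp : Order.disp_t) (T : bOrderType disp) : Prop :=
  [/\ well_order (<=%O : rel T),
      (forall a : T, countable [set b : T | b < a]%classic)
    & ~ countable [set: T]%classic].

(* Since a join of no elements is \bot, sup(∅) = 0, as for ordinals. *)
Definition fsup (disp : Order.disp_t) (T : bOrderType disp) (x : {fset T}) : T :=
  \join_(a <- x) a.

(* ⊛*(ω_1, ω_1, ω) when T is ω_1; see is_omega1. *)
Definition circledast_star (disp : Order.disp_t) (T : bOrderType disp) : Prop :=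
  exists d : {fset T} -> T,
  forall (n : nat) (X : 'I_n -> set {fset T}) (delta : T),
    (2 <= n)%N ->
    (forall i : 'I_n, ~ countable (X i)) ->
    exists x : 'I_n -> {fset T},
      [/\ forall i : 'I_n, X i (x i),
          forall i j : 'I_n, (i < j)%N -> fsup (x i) < fsup (x j)
        & forall z : {fset T},
            (\bigcup_(i in 'I_n) (x i `\` \bigcup_(j in 'I_n | j != i) x j)
               `<=` z)%fset ->
            (z `<=` \bigcup_(i in 'I_n) x i)%fset ->
            d z = delta].

Lemma uncountable_set_nat : ~ countable [set: set nat]%classic.
Proof.
move=> /countable_injP[f]; rewrite /set_inj => finj.
pose D : set nat := [set n | exists2 A : set nat, f A = n & ~ A n]%classic.
have [DfD|nDfD] := pselect (D (f D)).
  have [A fAD nA] := DfD.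
  by apply: nA; rewrite (finj A D) ?in_setT.
by apply: (nDfD); exists D.
Qed.

(* The class of models of is_omega1 is not empty. *)
Lemma omega1_exists :
  exists (disp : Order.disp_t) (T : bOrderType disp), is_omega1 T.
Proof.
have [R woR] := well_ordering_principle (set nat).
have Rchain : {in predT &, total R}.
  by apply: wo_chainW => A _ /woR.
have Rtot : total R by move=> x y; exact: Rchain.
have Rrefl : reflexive R by move=> x; have := Rtot x x; rewrite orbb.
have Ranti : antisymmetric R.
  have h : {in predT &, antisymmetric R}.
    by apply: wo_chain_antisymmetric => A _ /woR.
  by move=> x y; exact: h.
have Rtrans : transitive R.
  move=> y x z Rxy Ryz.
  have [|m [[mA mlb] _]] := woR [pred u | [|| u == x, u == y | u == z]].
    by exists x; rewrite inE eqxx.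
  have := mA; rewrite inE => /or3P[] /eqP em; rewrite em in mlb.
  - by apply: mlb; rewrite inE eqxx !orbT.
  - have e : x = y.
      by apply: Ranti; rewrite Rxy mlb // inE eqxx.
    by rewrite e.
  - have e : y = z.
      by apply: Ranti; rewrite Ryz mlb // inE eqxx orbT.
    by rewrite -e.
have [P [Pdown Pseg Punc]] : exists P : pred (set nat),
  [/\ forall x y, P x -> R y x -> P y,
      forall x, P x -> countable [set y | R y x && (y != x)]%classic
    & ~ countable [set y | P y]%classic].
  pose big x := ~ countable [set y | R y x && (y != x)]%classic.
  have [[x0 bx0]|nbig] := pselect (exists x, big x).
    have [|m [[]]] := woR [pred u | `[< big u >]].
      by exists x0; exact/asboolP.
    move=> /asboolP bm mlb _.
    exists [pred y | R y m && (y != m)]; split => //.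
    - move=> x y /= /andP[Rxm xm] Ryx.
      rewrite (Rtrans _ _ _ Ryx Rxm) /=; apply: contra xm => /eqP ym.
      by apply/eqP; apply: Ranti; rewrite Rxm -ym.
    - move=> x /= /andP[Rxm xm]; apply: contrapT => bx.
      move/negP: xm; apply; apply/eqP/Ranti; rewrite Rxm mlb //.
      exact/asboolP.
  exists predT; split => //.
  - by move=> x _; apply: contrapT => bx; apply: nbig; exists x.
  - have -> : [set y | predT y]%classic = [set: set nat]%classic.
      by apply/seteqP; split.
    exact: uncountable_set_nat.
pose S : choiceType := {x : set nat | P x}.
pose le : rel S := fun a b => R (val a) (val b).
have [x0 Px0] : exists x, P x.
  apply: contrapT => nP; apply: Punc.
  have -> : [set y | P y]%classic = set0.
    by apply/seteqP; split=> // y Py; case: nP; exists y.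
  exact: countable0.
have [|b0 [[Pb0 b0lb] _]] := woR P; first by exists x0.
pose o : S := exist _ b0 Pb0.
have le_refl : reflexive le by move=> a; exact: Rrefl.
have le_anti : antisymmetric le by move=> a b /Ranti /val_inj.
have le_trans : transitive le by move=> b a c; exact: Rtrans.
have le_tot : total le by move=> a b; exact: Rtot.
have le_o (a : S) : le o a by apply: b0lb; exact: (valP a).
pose disp := Order.Disp tt tt.
pose poM := Order.Le_isPOrder.Build disp S le_refl le_anti le_trans.
pose PO : porderType disp := HB.pack S poM.
pose totM := Order.POrder_isTotal.Build disp PO le_tot.
pose TO : orderType disp := HB.pack (Order.POrder.sort PO) totM PO.
pose botM := Order.hasBottom.Build disp TO le_o.
pose T : bOrderType disp := HB.pack (Order.Total.sort TO) botM TO.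
exists disp, T.
have leE (a b : T) : (a <= b) = R (val (a : S)) (val (b : S)) by [].
have val_injT : injective (fun a : T => val (a : S)) by exact: val_inj.
have cnt (A : set T) : countable ((fun a : T => val (a : S)) @` A)%classic ->
    countable A.
  by rewrite (eq_countable (inj_card_eq _)) // => a b _ _; exact: val_injT.
split.
- apply: antisymmetric_well_order; first exact: le_anti.
  move=> A [a0 Aa0].
  have [|m [[mA mlb] _]] := woR [pred u | `[< exists2 a : T, a \in A & val (a : S) = u >]].
    by exists (val (a0 : S)); apply/asboolP; exists a0.
  move: mA => /asboolP[a aA am]; exists a; split=> // b bA.
  by rewrite leE am; apply: mlb; apply/asboolP; exists b.
- move=> a; apply: cnt.
  apply: sub_countable (Pseg _ (valP (a : S))); apply: subset_card_le.
  move=> _ [b /= ba <-]; apply/andP; split; first by rewrite -leE ltW.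
  by apply/eqP => /val_injT e; rewrite e ltxx in ba.
- move=> cT; apply: Punc.
  have -> : [set y | P y]%classic = ((fun a : T => val (a : S)) @` setT)%classic.
    apply/seteqP; split; first by move=> y Py; exists (exist _ y Py).
    by move=> _ [a _ <-]; exact: (valP (a : S)).
  by apply: sub_countable cT; exact: card_image_le.
Qed.

(* Main.v *)
Require Import Defs.
From mathcomp Require Import all_boot all_order.
From mathcomp Require Import finmap boolp wochoice classical_sets functions.
From mathcomp Require Import cardinality zify.

(* Each uncountable family contains a Delta-system, so the theorem is about two
   unbounded families of finite sets: a (from the first family) and b (a union of
   members of the others), to be chosen with a < b. Let [ht] be the finite-to-one
   coherent map given by the maximal weight along a walk, and b* = max b. After
   thinning out, [ht _ b*] is bounded on b and on the roots, so the element of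
   z below b* with maximal height belongs to a; the colour of z is read off from
   the oscillation of this pair. By Moore's theorem one a admits several b's for
   which these oscillations are t, t + 1, t + 2, ..., hence the 2-adic valuation
   of one of them is the index of the required colour in a fixed enumeration of
   the ordinals below b*.

   Moore's theorem is proved by comparing [ht _ al] and [ht _ be] along the lower
   trace of the walk, at a level d reflecting countably many formulas. The lower
   trace of be at d is extended alternately by a block where the two heights are
   equal (coherence is reflected above d) and by a block where al is higher
   ([ht] is finite-to-one), and finally a is reflected below d. *)

Set Implicit Arguments.
Unset Strict Implicit.
Unset Printing Implicit Defensive.

Import Order.TTheory.
Local Open Scope order_scope.

(** * Well-founded induction and bounds for countable sequences *)

Section CountableBounds.
Variables (disp : Order.disp_t) (T : bOrderType disp) (hT : is_omega1 T).

Lemma omega1_wf : well_founded (fun x y : T => x < y).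
Proof.
have [wo _ _] := hT => x; apply: contrapT => nAx.
have [|m [[mA mlb] _]] := wo [pred u : T | `[< ~ Acc (fun x y : T => x < y) u >]].
  by exists x; exact/asboolP.
move: mA => /asboolP; apply; split=> y ym; apply: contrapT => nAy.
by move: ym; rewrite ltNge mlb //; exact/asboolP.
Qed.

Lemma omega1_ind (P : T -> Prop) :
  (forall x, (forall y, y < x -> P y) -> P x) -> forall x, P x.
Proof. by move=> IH; apply: (well_founded_ind omega1_wf) => x; exact: IH. Qed.

Lemma omega1_least (P : T -> Prop) :
  (exists x, P x) -> exists2 x, P x & forall y, P y -> x <= y.
Proof.
move=> [x0 Px0]; apply: contrapT => nex; move: Px0; move: x0.
apply: omega1_ind => x IH Px; apply: nex; exists x => // y Py.
by rewrite leNgt; apply/negP => /IH /(_ Py).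
Qed.

Lemma countable_bounded (u : nat -> T) : exists y, forall n, u n < y.
Proof.
have [_ cseg ncT] := hT; apply: contrapT => nb; apply: ncT.
have -> : [set: T]%classic =
    (\bigcup_(n in [set: nat]) ([set x | x < u n] `|` [set u n]))%classic.
  apply/seteqP; split=> // x _; apply: contrapT => nx; apply: nb; exists x => n.
  rewrite ltNge; apply/negP; rewrite le_eqVlt => /orP[/eqP xu|xu]; apply: nx.
    by exists n => //; right.
  by exists n => //; left.
apply: bigcup_countable => // n _.
rewrite -bigcup2E; apply: bigcup_countable => // -[|[|m]] _ //=.
Qed.

Lemma omega1_no_max (x : T) : exists y, x < y.
Proof. by have [y /(_ 0%N)] := countable_bounded (fun=> x); exists y. Qed.

Lemma finite_bounded (s : seq T) : exists y, forall x, x \in s -> x < y.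
Proof.
have [y uy] := countable_bounded (nth \bot s); exists y => x xs.
by rewrite -(nth_index \bot xs).
Qed.

(** If every [n] failed at some [u n], then no [n] would be good for a [y] above all [u n]. This
    fixes one of countably many parameters on an unbounded family. *)
Lemma omega1_pigeonhole (P : nat -> T -> Prop) :
  (forall y, exists n, P n y) ->
  (forall n y z, y <= z -> P n z -> P n y) -> exists n, forall y, P n y.
Proof.
move=> Pex Pmon; apply: contrapT => nP.
have /choice[u uP] : forall n, exists y, ~ P n y.
  by move=> n; apply/existsNP => Pn; apply: nP; exists n.
have [y uy] := countable_bounded u; have [n /Pmon Pn] := Pex y.
exact: uP (Pn _ (ltW (uy n))).
Qed.

Lemma increasing_inj (u : nat -> T) : (forall n, u n < u n.+1) ->
  forall s : seq T, ~ forall n, u n \in s.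
Proof.
move=> uS s us.
have umon : {homo u : m n / (m < n)%N >-> m < n}.
  by apply: homo_ltn => //; exact: lt_trans.
have uinj : injective u.
  by move=> m n umn; case: (ltngtP m n) => // /umon; rewrite umn ltxx.
have := @uniq_leq_size _ (map u (iota 0 (size s).+1)) s.
rewrite (map_inj_uniq uinj) iota_uniq size_map size_iota ltnn => h.
by suff: false by []; apply: h => // _ /mapP[n _ ->].
Qed.

End CountableBounds.

(** * Ladders, walks, heights and lower traces *)

Section Walks.
Variables (disp : Order.disp_t) (T : bOrderType disp) (hT : is_omega1 T).

Lemma omega1_index : exists i : T -> T -> nat,
  forall b x y, x < b -> y < b -> i b x = i b y -> x = y.
Proof.
have [_ cseg _] := hT.
have /choice[i iP] : forall b, exists f : T -> nat,
    {in [set x | x < b]%classic &, injective f}.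
  by move=> b; apply/countable_injP; exact: cseg.
by exists i => b x y xb yb; apply: iP; rewrite inE.
Qed.

Variable i : T -> T -> nat.
Hypothesis i_inj : forall b x y, x < b -> y < b -> i b x = i b y -> x = y.

Lemma finite_index_le b n : finite_set [set x | x < b /\ (i b x <= n)%N]%classic.
Proof.
elim: n => [|n IHn].
  have [[x [xb]]|nx] := pselect (exists x, x < b /\ (i b x <= 0)%N).
    rewrite leqn0 => /eqP ix; apply: sub_finite_set (finite_set1 x).
    move=> y [yb]; rewrite leqn0 => /eqP iy /=.
    by apply: (i_inj yb xb); rewrite ix.
  apply: sub_finite_set (finite_set0 T) => y /= yP; apply: nx; by exists y.
have [[x [xb ix]]|nx] := pselect (exists x, x < b /\ i b x = n.+1).
  apply: (@sub_finite_set _ _ ([set x] `|` [set x | x < b /\ (i b x <= n)%N])%classic).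
    move=> y [yb]; rewrite leq_eqVlt => /orP[/eqP iy|iy]; last by right.
    by left; apply: (i_inj yb xb); rewrite ix.
  by rewrite finite_setU; split.
apply: sub_finite_set IHn => y [yb]; rewrite leq_eqVlt => /orP[/eqP iy|//].
by case: nx; exists y.
Qed.

(* The elements [x] of a ladder [C_b] cofinal in [b] are those with
   [step x b = x]; then [step a b] is the least element of [C_b] above [a]. *)
Definition step (a b : T) : T :=
  xget b [set x | [/\ a <= x, x < b &
                      forall y, a <= y -> y < b -> (i b x <= i b y)%N]]%classic.

Lemma stepP a b : a < b ->
  [/\ a <= step a b, step a b < b &
      forall y, a <= y -> y < b -> (i b (step a b) <= i b y)%N].
Proof.
move=> ab; apply: (@xgetPex T b [set x | [/\ a <= x, x < b &
  forall y, a <= y -> y < b -> (i b x <= i b y)%N]]%classic).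
have exi : exists n, `[< exists2 x, a <= x < b & i b x = n >].
  by exists (i b a); apply/asboolP; exists a; rewrite ?lexx.
case: (ex_minnP exi) => n /asboolP[x /andP[ax xb] ixn] nmin.
exists x; split => // y ay yb; rewrite ixn; apply: nmin; apply/asboolP.
by exists y; rewrite ?ay.
Qed.

Lemma step_ge a b : a < b -> a <= step a b.
Proof. by case/stepP. Qed.

Lemma step_lt a b : a < b -> step a b < b.
Proof. by case/stepP. Qed.

Lemma step_min a b y : a <= y -> y < b -> (i b (step a b) <= i b y)%N.
Proof. by move=> ay yb; case: (stepP (le_lt_trans ay yb)) => _ _; apply. Qed.

Lemma step_eq a b c : a <= b -> b <= step a c -> b < c -> step a c = step b c.
Proof.
move=> ab bs bc; have ac := le_lt_trans ab bc.
apply: (@i_inj c); [exact: step_lt|exact: step_lt|].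
apply/eqP; rewrite eqn_leq !step_min ?step_lt //.
by rewrite (le_trans ab) // step_ge.
Qed.

Lemma step_idem a b : a < b -> step (step a b) b = step a b.
Proof. by move=> ab; rewrite -(step_eq (step_ge ab)) ?step_lt. Qed.

(** Ladders have order type at most omega: for every [x < a], [step a b] competes with [step x b],
    so its index bounds that of [step x b]. *)
Lemma finite_steps a b : a < b ->
  finite_set [set step x b | x in [set x | x < a]]%classic.
Proof.
move=> ab; apply: sub_finite_set (finite_index_le b (i b (step a b))).
move=> _ [x /= xa <-]; have xb := lt_trans xa ab.
by split; [exact: step_lt | rewrite step_min ?(le_trans (ltW xa)) ?step_ge ?step_lt].
Qed.

Definition walk_body (a b : T) (rec : forall y, y < b -> seq T) : seq T :=
  if pselect (a < b) is left ab then b :: rec (step a b) (step_lt ab) else [::].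

Definition walk (a b : T) : seq T :=
  Fix (omega1_wf hT) (fun=> seq T) (walk_body a) b.

Lemma walkE a b : walk a b = if a < b then b :: walk a (step a b) else [::].
Proof.
rewrite /walk Fix_eq => [|x f g fg]; rewrite /walk_body.
  by case: pselect => [->|/negP/negbTE ->].
by case: pselect => // ab; rewrite fg.
Qed.

Lemma walk_ind (P : T -> T -> Prop) (a : T) :
  P a a -> (forall b, a < b -> P a (step a b) -> P a b) ->
  forall b, a <= b -> P a b.
Proof.
move=> Pa PS; apply: (omega1_ind hT) => b IH.
rewrite le_eqVlt => /orP[/eqP <- //|ab].
by apply: PS => //; apply: IH; [exact: step_lt|exact: step_ge].
Qed.

(** Todorcevic's rho_1, with a step weighed by the index of its target instead of by the number of
    ladder elements below [a]. *)
Definition ht (a b : T) : nat :=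
  foldr maxn 0%N [seq i g (step a g) | g <- walk a b].

Lemma htE a b : a < b -> ht a b = maxn (i b (step a b)) (ht a (step a b)).
Proof. by move=> ab; rewrite /ht walkE ab. Qed.

(** By induction on [b]: the first step leads to one of finitely many [c] of index at most [n], and
    the rest of the walk again has height at most [n]. *)
Lemma finite_ht_le b n : finite_set [set x | x < b /\ (ht x b <= n)%N]%classic.
Proof.
move: b; apply: (omega1_ind hT) => b IH.
apply: (@sub_finite_set _ _ (\bigcup_(c in [set c | c < b /\ (i b c <= n)%N])
   ([set c] `|` [set x | x < c /\ (ht x c <= n)%N]))%classic).
  move=> x [xb]; rewrite htE // geq_max => /andP[ix hx].
  exists (step x b); first by split => //; exact: step_lt.
  by have := step_ge xb; rewrite le_eqVlt => /orP[/eqP xs|xs]; [left|right].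
apply: bigcup_finite; first exact: finite_index_le.
by move=> c [cb _]; rewrite finite_setU; split=> //; exact: IH.
Qed.

(** By induction on the larger argument [b]: for [x < a] the first step from [b] has finitely many
    targets [c]. Apart from [c] and the finitely many [x] of height at most [i b c] over [c], this
    step does not affect the height of [x], and [x] is a disagreement between [c] and [a]. *)
Lemma ht_coherent a b :
  finite_set [set x | [/\ x < a, x < b & ht x a != ht x b]]%classic.
Proof.
pose D a b := [set x | [/\ x < a, x < b & ht x a != ht x b]]%classic.
have DC a' b' : D a' b' = D b' a'.
  by apply/seteqP; split=> x [*]; split; rewrite 1?eq_sym.
have H : forall b a, a < b -> finite_set (D a b).
  move=> {a}{}b; move: b; apply: (omega1_ind hT) => b IH a ab.
  apply: (@sub_finite_set _ _ (\bigcup_(c in [set step x b | x in [set x | x < a]])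
     ([set c] `|` ([set x | x < c /\ (ht x c <= i b c)%N] `|` D c a)))%classic).
    move=> x [xa xb hx]; exists (step x b); first by exists x.
    have := step_ge xb; rewrite le_eqVlt => /orP[/eqP xs|xs]; [by left|right].
    move: hx; rewrite (htE xb); case: (leqP _ (ht x (step x b))) => [hx hn|/ltnW hx _].
      by right; split; rewrite // eq_sym.
    by left.
  apply: bigcup_finite; first exact: finite_steps.
  move=> c [x xa <-]; rewrite !finite_setU; split=> //; split.
    exact: finite_ht_le.
  case: (ltgtP (step x b) a) => [sa|sa|->].
  - exact: IH.
  - by rewrite DC; apply: IH => //; rewrite step_lt // (lt_trans xa).
  - by apply: sub_finite_set (finite_set0 T) => y [_ _]; rewrite eqxx.
case: (ltgtP a b) => [ab|ba|->].
- exact: H.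
- by rewrite -/(D a b) DC; exact: H.
- by apply: sub_finite_set (finite_set0 T) => y [_ _]; rewrite eqxx.
Qed.

(* [lam a b] is the largest element of the ladder of [b] below [a] (and \bot if
   there is none). *)
Definition lam (a b : T) : T :=
  xget \bot [set m | (forall x, m < x -> x <= a -> a <= step x b) /\
    forall m', (forall x, m' < x -> x <= a -> a <= step x b) -> m <= m']%classic.

Lemma lamP a b :
  (forall x, lam a b < x -> x <= a -> a <= step x b) /\
  forall m', (forall x, m' < x -> x <= a -> a <= step x b) -> lam a b <= m'.
Proof.
apply: (@xgetPex T \bot [set m | (forall x, m < x -> x <= a -> a <= step x b) /\
  forall m', (forall x, m' < x -> x <= a -> a <= step x b) -> m <= m']%classic).
have [|m ma mmin] := @omega1_least _ T hT
    (fun m => forall x, m < x -> x <= a -> a <= step x b).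
  by exists a => x ax /(lt_le_trans ax); rewrite ltxx.
by exists m.
Qed.

Lemma finite_max (A : set T) a : \bot < a -> finite_set A ->
  (forall x, A x -> x < a) -> exists2 m, m < a & forall x, A x -> x <= m.
Proof.
move=> a0 /finite_seqP[s ->] sa; exists (\join_(x <- s) x).
  by rewrite big_seq; elim/big_ind: _ => // x y xa ya; rewrite ltUx xa.
by move=> x /= xs; apply: joins_sup_seq.
Qed.

Lemma lam_lt a b : \bot < a -> a < b -> lam a b < a.
Proof.
move=> a0 ab.
have [||m ma mP] := @finite_max ([set step x b | x in [set x | x < a]] `&`
    [set x | x < a])%classic a a0.
- by apply: finite_setIl; exact: finite_steps.
- by move=> x [].
apply: le_lt_trans ma; apply: (lamP a b).2 => x mx.
rewrite le_eqVlt => /orP[/eqP ->|xa].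
  exact: step_ge.
rewrite leNgt; apply/negP => sa.
have /(lt_le_trans mx) : x <= m.
  by apply: le_trans (step_ge (lt_trans xa ab)) (mP _ _); split=> //; exists x.
by rewrite ltxx.
Qed.

Lemma lam_ge a b c : c < a -> a <= b -> step c b = c -> c <= lam a b.
Proof.
move=> ca ab cc; rewrite leNgt; apply/negP => /(lamP a b).1 /(_ (ltW ca)).
by rewrite cc leNgt ca.
Qed.

(** The ladder of [c] has no element [x] with [a <= x < b], so [a] and [b] cut it at the same
    place. *)
Lemma lam_eq a b c : a <= b -> b < c -> lam b c < a ->
  lam a c = lam b c /\ step a c = step b c.
Proof.
move=> ab bc la; have stE : step a c = step b c.
  by apply: step_eq => //; exact: (lamP b c).1.
split=> //; apply/eqP; rewrite eq_le; apply/andP; split.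
  apply: (lamP a c).2 => x lx xa; apply: (le_trans ab).
  by apply: (lamP b c).1 => //; exact: le_trans ab.
apply: (lamP b c).2 => x lx xb; case: (leP x a) => [xa|/ltW ax].
  rewrite (step_eq xa ((lamP a c).1 _ lx xa)) ?(le_lt_trans ab) // stE.
  exact: step_ge.
have bs := step_ge bc.
by rewrite -(step_eq ax _ (le_lt_trans xb bc)) stE // (le_trans xb).
Qed.

(** Moore's lower trace as a strictly increasing list: the distinct running maxima of [lam a] along
    the walk from [b] to [a]. *)
Definition ltrace (a b : T) : seq T :=
  foldr (fun g s => lam a g :: [seq x <- s | lam a g < x]) [::] (walk a b).

Lemma ltraceaa a : ltrace a a = [::].
Proof. by rewrite /ltrace walkE ltxx. Qed.

Lemma ltraceE a b : a < b ->
  ltrace a b = lam a b :: [seq x <- ltrace a (step a b) | lam a b < x].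
Proof. by move=> ab; rewrite /ltrace walkE ab. Qed.

Lemma ltrace_lt a b x : \bot < a -> a <= b -> x \in ltrace a b -> x < a.
Proof.
move=> a0 ab; move: b ab x.
apply: (@walk_ind (fun a b => forall x, x \in ltrace a b -> x < a)).
  by move=> x; rewrite ltraceaa.
move=> b ab IH x; rewrite ltraceE // inE mem_filter => /orP[/eqP ->|/andP[_ /IH//]].
exact: lam_lt.
Qed.

Lemma ltrace_ge a b c x : c < a -> a < b -> step c b = c ->
  x \in ltrace a b -> c <= x.
Proof.
move=> ca ab cc; have cl := lam_ge ca (ltW ab) cc; rewrite ltraceE // inE mem_filter.
by move=> /orP[/eqP -> //|/andP[/ltW lx _]]; exact: le_trans lx.
Qed.

(** By induction along the walk from [c] to [b]: since [lam b c < a], the walk from [c] to [a]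
    begins with the same step and the same [lam]. *)
Lemma ltrace_cat a b c : a <= b -> b <= c ->
  (forall x, x \in ltrace b c -> x < a) ->
  (forall x y, x \in ltrace b c -> y \in ltrace a b -> x < y) ->
  ltrace a c = ltrace b c ++ ltrace a b.
Proof.
move=> ab bc; move: c bc.
apply: (@walk_ind (fun b c => (forall x, x \in ltrace b c -> x < a) ->
  (forall x y, x \in ltrace b c -> y \in ltrace a b -> x < y) ->
  ltrace a c = ltrace b c ++ ltrace a b)) => [|c bc IH].
  by rewrite ltraceaa.
rewrite ltraceE // => xa xy.
have ac := le_lt_trans ab bc.
have la : lam b c < a by apply: xa; rewrite mem_head.
have [lE sE] := lam_eq ab bc la.
(* An element dropped by the filter is at most [lam b c], which is in the trace, so it inherits both
   hypotheses. *)
have lP x : x \in ltrace b (step b c) -> x <= lam b c \/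
    x \in lam b c :: [seq x <- ltrace b (step b c) | lam b c < x].
  move=> xs; case: (leP x (lam b c)) => lx; [by left|right].
    by rewrite inE mem_filter lx xs orbT.
rewrite (ltraceE ac) lE sE IH; last 2 first.
- by move=> x /lP[xl|/xa //]; exact: le_lt_trans xl la.
- move=> x y /lP[xl|/xy h /h//] yab; apply: le_lt_trans xl _; apply: xy => //.
  exact: mem_head.
rewrite filter_cat /=; congr (_ :: (_ ++ _)); apply/all_filterP/allP => y yab.
by apply: xy => //; exact: mem_head.
Qed.

End Walks.

(** * Counting rises in sign sequences *)

Fixpoint rises (p : bool) (s : seq bool) : nat :=
  if s is x :: s' then ((~~ p && x) + rises x s')%N else 0%N.

Lemma rises_cat p s t : rises p (s ++ t) = (rises p s + rises (last p s) t)%N.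
Proof. by elim: s p => //= x s IH p; rewrite IH addnA. Qed.

Lemma rises_nseq p b n : rises p (nseq n.+1 b) = (~~ p && b).
Proof.
rewrite /=; have -> : rises b (nseq n b) = 0%N; last by rewrite addn0.
by elim: n => //= n ->; rewrite andNb.
Qed.

Lemma last_nseq (p b : bool) n : last p (nseq n.+1 b) = b.
Proof. by elim: n p => //= n IH p; rewrite IH. Qed.

(** * Reflection and Moore's oscillation theorem *)

Section Oscillation.
Variables (disp : Order.disp_t) (T : bOrderType disp) (hT : is_omega1 T).
Variable i : T -> T -> nat.
Hypothesis i_inj : forall b x y, x < b -> y < b -> i b x = i b y -> x = y.

Let e := ht hT i.
Let L := ltrace hT i.
Let stp := step i.

(* A substitute for elementary submodels: [Sk k w s z] says that [z] witnesses
   the [k]-th formula with parameters [w] and [s]. *)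
Definition reflects (Sk : nat -> seq (seq nat) -> seq (seq T) -> T -> Prop)
    (d : T) :=
  forall k w (s : seq (seq T)), (forall t x, t \in s -> x \in t -> x < d) ->
  (exists z, Sk k w s z) -> exists2 z, z < d & Sk k w s z.

(** Indices give the parameters below [b] countably many codes, so some [h b] exceeds chosen
    witnesses for all of them. The level [d] is the supremum of the iterates of [h], and finitely
    many points below [d] lie below one iterate. *)
Lemma ex_reflects Sk : exists d, reflects Sk d.
Proof.
have /choice[j jP] : forall b, exists f : nat -> T, forall x, x < b -> f (i b x) = x.
  move=> b; have /choice[f fP] : forall n, exists x,
      forall y, y < b -> i b y = n -> x = y.
    move=> n; have [[x [xb ix]]|nx] := pselect (exists x, x < b /\ i b x = n).
      by exists x => y yb iy; apply: (i_inj xb yb); rewrite ix.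
    by exists b => y yb iy; case: nx; exists y.
  by exists f => x xb; exact: fP.
have /choice[g gP] : forall p : nat * seq (seq nat) * seq (seq T), exists z,
    (exists z', Sk p.1.1 p.1.2 p.2 z') -> Sk p.1.1 p.1.2 p.2 z.
  move=> p; have [[z zP]|nz] := pselect (exists z', Sk p.1.1 p.1.2 p.2 z').
    by exists z.
  by exists \bot.
have /choice[h hP] : forall b, exists z, b < z /\ forall k w (s : seq (seq T)),
    (forall t x, t \in s -> x \in t -> x < b) -> g (k, w, s) < z.
  move=> b.
  pose u n := if @choice.unpickle (nat * seq (seq nat) * seq (seq nat))%type n
    is Some (k, w, c) then
    g (k, w, map (map (j b)) c : seq (seq T)) else b.
  have [z uz] := countable_bounded hT u; have [y by_] := omega1_no_max hT b.
  exists (Order.max y z); split; first by rewrite lt_max by_.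
  move=> k w s sb; rewrite lt_max; apply/orP; right.
  have := uz (choice.pickle (k, w, map (map (i b)) s)); rewrite /u choice.pickleK.
  suff -> : map (map (j b)) (map (map (i b)) s) = s by [].
  rewrite -map_comp -[RHS]map_id; apply/eq_in_map => t ts /=.
  rewrite -map_comp -[RHS]map_id; apply/eq_in_map => x xt /=.
  exact/jP/(sb t).
pose eta n := iter n h \bot.
have etaS n : eta n < eta n.+1 := (hP (eta n)).1.
have eta_mono : {homo eta : m n / (m <= n)%N >-> m <= n}.
  by apply: homo_leq => //; [exact: le_trans|move=> n; exact: ltW].
have [|d dP dmin] := @omega1_least _ T hT (fun d => forall n, eta n < d).
  by have [d dP] := countable_bounded hT eta; exists d.
have below x : x < d -> exists n, x < eta n.
  move=> xd; apply: contrapT => nx; move: xd; rewrite ltNge => /negP; apply.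
  apply: dmin => n; apply: lt_le_trans (etaS n) _; rewrite leNgt; apply/negP => xn.
  by apply: nx; exists n.+1.
have below_seq (t : seq T) : (forall x, x \in t -> x < d) ->
    exists n, forall x, x \in t -> x < eta n.
  elim: t => [|y t IH] td; first by exists 0%N.
  have [|n nP] := IH; first by move=> x xt; apply: td; rewrite inE xt orbT.
  have [m mP] := below y (td y (mem_head _ _)); exists (maxn m n) => x.
  rewrite inE => /orP[/eqP ->|/nP xn].
    by apply: lt_le_trans mP _; exact: eta_mono (leq_maxl _ _).
  by apply: lt_le_trans xn _; exact: eta_mono (leq_maxr _ _).
exists d => k w s sd ez; exists (g (k, w, s)); last exact: (gP (k, w, s)).
have [|n nP] := below_seq (flatten s).
  by move=> x /flattenP[t ts xt]; exact: sd xt.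
apply: lt_trans (dP n.+1); apply: (hP (eta n)).2 => t x ts xt; apply: nP.
by apply/flattenP; exists t.
Qed.

Definition above (y : T) (a : seq T) := forall x, x \in a -> y < x.
Definition below (a : seq T) (y : T) := forall x, x \in a -> x < y.

Lemma above_le y z a : y <= z -> above z a -> above y a.
Proof. by move=> yz za x /za; exact: le_lt_trans. Qed.

(* On an infinite sequence of blocks [l] the heights [e x al] cannot all
   stay bounded, since [e] is finite-to-one. *)
Lemma unbounded_ht (F : seq T -> Prop) :
  (forall y, exists2 a, F a & above y a) ->
  exists z, forall l n, above z l -> forall y,
    exists a, [/\ F a, above y a & forall al x, al \in a -> x \in l -> (n < e x al)%N].
Proof.
move=> Funb.
pose good (l : seq T) n := forall y,
  exists a, [/\ F a, above y a & forall al x, al \in a -> x \in l -> (n < e x al)%N].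
suff /choice[u uP] : forall n, exists z, forall l, above z l -> good l n.
  have [z uz] := countable_bounded hT u; exists z => l n zl.
  by apply: uP; apply: above_le zl; exact: ltW.
move=> n; apply: contrapT => nz.
(* [h z] bounds a bad block [l] above [z] and the point [y] at which it is bad. A single [a] above
   all iterates of [h] then has a low height in each of infinitely many blocks. *)
have /choice[h hP] : forall z, exists h, z < h /\ exists l, [/\ above z l, below l h &
    ~ exists a, [/\ F a, above h a &
          forall al x, al \in a -> x \in l -> (n < e x al)%N]].
  move=> z; move/forallNP: nz => /(_ z) /existsNP[l /not_implyP[zl /existsNP[y ny]]].
  have [m mP] := finite_bounded hT [:: z, y & l].
  exists m; split; first by rewrite mP // mem_head.
  exists l; split=> // [x xl|[a [Fa ma aP]]].
    by apply: mP; rewrite !inE xl !orbT.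
  apply: ny; exists a; split=> //; apply: above_le ma.
  by rewrite ltW // mP // !inE eqxx orbT.
pose eta k := iter k h \bot.
have [z etaz] := countable_bounded hT eta.
have [a Fa za] := Funb z.
have /choice[v vP] : forall k, exists x, [/\ eta k < x, x < eta k.+1 &
    exists2 al, al \in a & (e x al <= n)%N].
  move=> k; have [_ [l [zl lh]]] := hP (eta k); move/forallNP/(_ a) => na.
  apply: contrapT => nx; apply: na; split=> //.
    by apply: above_le za; exact: ltW (etaz k.+1).
  move=> al x ala xl; rewrite ltnNge; apply/negP => exn; apply: nx; exists x.
  by split; [exact: zl|exact: lh|exists al].
have : finite_set (\bigcup_(al in [set` a])
    [set x | x < al /\ (e x al <= n)%N])%classic.
  by apply: bigcup_finite => // al _; exact: finite_ht_le.
move=> /finite_seqP[s sE].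
apply: (@increasing_inj _ T v _ s) => k.
  by have [_ h1 _] := vP k; have [h2 _ _] := vP k.+1; exact: lt_trans h2.
have [_ h1 [al ala ev]] := vP k.
have : (\bigcup_(al in [set` a]) [set x | x < al /\ (e x al <= n)%N])%classic (v k).
  exists al => //; split=> //; apply: lt_trans h1 _.
  by apply: lt_trans (etaz _) _; exact: za.
by rewrite sE.
Qed.

Variables (A : seq T -> Prop) (B : T -> T -> Prop).
Hypothesis A_unb : forall y, exists2 a, A a & above y a.
Hypothesis B_unb : forall y, exists b, B y b.
Hypothesis B_mono : forall y z b, y <= z -> B z b -> B y b.
Hypothesis B_lt : forall y b, B y b -> y < b.

Definition vals (a q : seq T) := [seq [seq e x al | x <- q] | al <- a].

Lemma vals_mem a a' q al : vals a' q = vals a q -> al \in a' ->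
  exists2 al', al' \in a & {in q, e^~ al =1 e^~ al'}.
Proof.
move=> va ala; have : [seq e x al | x <- q] \in vals a q.
  by rewrite -va; apply/mapP; exists al.
by move=> /mapP[al' ala' /eq_in_map h]; exists al'.
Qed.

Lemma vals_take a q l : vals a q = map (take (size q)) (vals a (q ++ l)).
Proof.
by rewrite -map_comp; apply: eq_map => al /=; rewrite map_cat take_size_cat ?size_map.
Qed.

Lemma vals1 b b' q : vals [:: b'] q = vals [:: b] q -> {in q, e^~ b' =1 e^~ b}.
Proof. by case=> /eq_in_map. Qed.

(** All that is to be copied from a pair [a], [b] at the level [d] to a pair at a higher level. *)
Definition twins q c w l d := [/\ c < d, stp c d = c &
  exists a b, [/\ A a, above d a, B d b & [/\ vals a q ++ vals [:: b] q = w, L d b = l &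
    forall al x, al \in a -> c <= x -> x < d -> e x al = e x b]]].

(* [s] lists [q] and [c :: l]; [w] codes the heights over [q], so that every
   formula has only finitely many parameters. *)
Definition moore_formulas (k : nat) w (s : seq (seq T)) z :=
  match k with
  | 0%N => forall d,
      twins (nth [::] s 0) (head \bot (nth [::] s 1)) w (behead (nth [::] s 1)) d ->
      d <= z
  | 1%N => forall t n, above z t -> forall y, exists a,
      [/\ A a, vals a (nth [::] s 0) = w, above y a &
          forall al x, al \in a -> x \in t -> (n < e x al)%N]
  | 2%N => exists a, [/\ A a, vals a (nth [::] s 0) = w, 
              above (head \bot (nth [::] s 1)) a & below a z]
  | 3%N => forall a, A a -> vals a (nth [::] s 0) = w -> ~ above z a
  | _ => below (nth [::] s 0) z
  end.

(** * Extending lower traces at a reflecting level *)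

Section Closed.
Variable d : T.
Hypothesis dP : reflects moore_formulas d.

Lemma closed_above q : below q d ->
  exists c, [/\ c < d, stp c d = c, below q c & \bot < c].
Proof.
move=> qd; have [||y yd yP] := dP (k := 4%N) (w := [::]) (s := [:: q]).
- by move=> t x; rewrite inE => /eqP ->; exact: qd.
- exact: finite_bounded.
(* The second point makes the ladder element exceed [\bot] even if [q] is empty. *)
have [||z zd zP] := dP (k := 4%N) (w := [::]) (s := [:: [:: y]]).
- by move=> t x; rewrite inE => /eqP ->; rewrite inE => /eqP ->.
- exact: finite_bounded.
have yz : y < z by apply: zP; rewrite mem_head.
exists (stp z d); split.
- exact: step_lt.
- exact: step_idem.
- move=> x /yP xy; apply: lt_le_trans (step_ge i zd); exact: lt_trans yz.
- by apply: lt_le_trans (step_ge i zd); apply: le_lt_trans yz; exact: le0x.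
Qed.

Lemma closed_gt0 : \bot < d.
Proof. by have [|c [cd _ _ c0]] := @closed_above [::] => //; exact: lt_trans cd. Qed.

Lemma closed_avoid q (S : set T) : below q d -> finite_set S ->
  exists c, [/\ c < d, stp c d = c, below q c & forall x, c <= x -> x < d -> ~ S x].
Proof.
move=> qd /finite_seqP[s ->].
have [|c [cd cc qc _]] := @closed_above (q ++ [seq x <- s | x < d]).
  by move=> x; rewrite mem_cat mem_filter => /orP[/qd//|/andP[]].
exists c; split=> // [x xq|x cx xd /= xs]; first by apply: qc; rewrite mem_cat xq.
by have := qc x; rewrite mem_cat mem_filter xd xs orbT ltNge cx => /(_ isT).
Qed.

Lemma L_below b : d < b -> below (L d b) d.
Proof. by move=> db x; apply: ltrace_lt => //; [exact: closed_gt0|exact: ltW]. Qed.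

(** By coherence all of [a] agrees with [b] on some interval from [c] to [d], so [d] is a level of
    twins. If no such level were above [d], a bound for these levels would reflect to some [z < d],
    and [d] itself would violate it. *)
Lemma twins_above a b q : A a -> above d a -> B d b -> below q d ->
  exists c d' a' b', [/\ [/\ c < d, d < d', stp c d' = c & below q c],
    [/\ A a', above d' a', vals a' q = vals a q &
        forall al x, al \in a' -> c <= x -> x < d' -> e x al = e x b'] &
    [/\ B d' b', vals [:: b'] q = vals [:: b] q & L d' b' = L d b]].
Proof.
move=> Aa da db qd.
have : finite_set (\bigcup_(al in [set` a])
    [set x | [/\ x < al, x < b & e x al != e x b]])%classic.
  by apply: bigcup_finite => // al _; exact: ht_coherent.
move=> /(closed_avoid qd)[c [cd cc qc cS]].
have td : twins q c (vals a q ++ vals [:: b] q) (L d b) d.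
  split=> //; exists a, b; split=> //; split=> // al x ala cx xd.
  apply/eqP; case: (boolP (e x al == e x b)) => // exn.
  case: (cS x cx xd); exists al => //; split=> //.
    by apply: lt_trans (da _ ala).
  exact: lt_trans (B_lt db).
suff [d' dd' [cd' cc' [a' [b' [Aa' da' Bb' [vE LE ab']]]]]] :
    exists2 d', d < d' & twins q c (vals a q ++ vals [:: b] q) (L d b) d'.
  have /eqP := vE; rewrite !cats1 eqseq_rcons => /andP[/eqP va /eqP vb].
  by exists c, d', a', b'; split; split=> //; rewrite /vals /= vb.
apply: contrapT => nd'.
have [||z zd] := dP (k := 0%N) (w := vals a q ++ vals [:: b] q)
  (s := [:: q; c :: L d b]).
- move=> t x; rewrite !inE => /orP[/eqP ->|/eqP ->]; first exact: qd.
  by rewrite inE => /orP[/eqP -> //|]; exact: L_below (B_lt db) _.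
- exists d => d' /= td'; rewrite leNgt; apply/negP => dd'; apply: nd'.
  by exists d'.
by move=> /(_ d td); rewrite leNgt zd.
Qed.

(** The trace from [b'] to [d'] lies below [c]. As [c] is in the ladder of [d'], the trace from [d']
    to [d] lies above or at [c], so the two concatenate. *)
Lemma twins_L c d' b' q : c < d -> d < d' -> stp c d' = c -> below q c -> B d' b' ->
  {subset L d' b' <= q} ->
  L d b' = L d' b' ++ L d d' /\ forall x, x \in L d d' -> c <= x < d.
Proof.
move=> cd dd' cc qc Bb' Lq.
have Lc x : x \in L d d' -> c <= x by apply: ltrace_ge.
split; last first.
  by move=> x xL; rewrite Lc //; apply: (ltrace_lt i_inj closed_gt0 (ltW dd') xL).
apply: ltrace_cat => // [||x /Lq/qc xc|x y /Lq/qc xc yL].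
- exact: ltW.
- exact/ltW/B_lt.
- exact: lt_trans xc cd.
- exact: lt_le_trans xc (Lc _ yL).
Qed.

Lemma L_neq0 b : d < b -> L d b != [::].
Proof. by move=> db; rewrite /L ltraceE. Qed.

Lemma extend_eq a b q : A a -> above d a -> B d b -> below q d ->
  {subset L d b <= q} ->
  exists a' b' l, [/\ [/\ A a', above d a', B d b' & below l d],
    vals a' q = vals a q, vals [:: b'] q = vals [:: b] q, L d b' = L d b ++ l &
    l != [::] /\ forall al x, al \in a' -> x \in l -> e x al = e x b'].
Proof.
move=> Aa da Bb qd Lq.
have [c [d' [a' [b' [[cd dd' cc qc] [Aa' da' va ab] [Bb' vb LE]]]]]] :=
  twins_above Aa da Bb qd.
have [|LE' Lcd] := twins_L cd dd' cc qc Bb'; first by rewrite LE.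
exists a', b', (L d d'); split=> //.
- split=> //; [exact: above_le (ltW dd') da'|exact: B_mono (ltW dd') Bb'|].
  by move=> x /Lcd/andP[].
- by rewrite LE' LE.
- split; first exact: L_neq0.
  by move=> al x ala /Lcd/andP[cx xd]; apply: ab => //; exact: lt_trans dd'.
Qed.

(** Only [b'] is taken from the twins. Once the block is known, [a'] is chosen anew, with heights
    above the maximum of those of [b'] on the block. *)
Lemma extend_gt a b q : A a -> above d a -> B d b -> below q d ->
  {subset L d b <= q} ->
  exists a' b' l, [/\ [/\ A a', above d a', B d b' & below l d],
    vals a' q = vals a q, vals [:: b'] q = vals [:: b] q, L d b' = L d b ++ l &
    l != [::] /\ forall al x, al \in a' -> x \in l -> (e x b' < e x al)%N].
Proof.
move=> Aa da Bb qd Lq.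
have [||z zd zP] := dP (k := 1%N) (w := vals a q) (s := [:: q]).
- by move=> t x; rewrite inE => /eqP ->; exact: qd.
- have [|z zP] := @unbounded_ht (fun a' => A a' /\ vals a' q = vals a q).
    move=> y; apply: contrapT => ny.
    (* A point with no suitable [a'] above it would reflect below [d], but [a] is above [d]. *)
    have [||z zd /(_ a Aa erefl)] := dP (k := 3%N) (w := vals a q) (s := [:: q]).
    + by move=> t x; rewrite inE => /eqP ->; exact: qd.
    + by exists y => a' Aa' va ya; apply: ny; exists a'.
    + by apply; exact: above_le (ltW zd) da.
  exists z => t n zt y; have [a' [[]]] := zP t n zt y.
  by exists a'.
(* Adding [z] to [q] puts the new block above [z]. *)
have [|c [d' [_ [b' [[cd dd' cc qc] _ [Bb' vb LE]]]]]] :=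
    @twins_above a b (z :: q) Aa da Bb.
  by move=> x; rewrite inE => /orP[/eqP ->|/qd].
have qc' : below q c by move=> x xq; apply: qc; rewrite inE xq orbT.
have [|LE' Lcd] := twins_L cd dd' cc qc' Bb'; first by rewrite LE.
have [a' [Aa' va da' aP]] : exists a', [/\ A a', vals a' q = vals a q, above d a' &
    forall al x, al \in a' -> x \in L d d' ->
      ((\max_(x <- L d d') e x b')%N < e x al)%N].
  apply: (zP (L d d')) => x /Lcd/andP[cx _]; apply: lt_le_trans cx.
  by apply: qc; rewrite mem_head.
exists a', b', (L d d'); split=> //.
- by split=> //; [exact: B_mono (ltW dd') Bb'|move=> x /Lcd/andP[]].
- by case: vb => _ vb; rewrite /vals /= vb.
- by rewrite LE' LE.
- split; first exact: L_neq0.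
  move=> al x ala xL; apply: leq_ltn_trans (aP al x ala xL).
  exact: leq_bigmax_seq.
Qed.


(** * Oscillation along the lower trace *)

Definition signs al b (s : seq T) := [seq (e x b < e x al)%N | x <- s].

(** Moore's oscillation number; the initial [true] keeps the first element of the trace, which has
    no predecessor, from counting. *)
Definition osc al b := rises true (signs al b (L al b)).

Lemma eq_signs al b al' b' (s q : seq T) : {subset s <= q} ->
  {in q, e^~ al =1 e^~ al'} -> {in q, e^~ b =1 e^~ b'} ->
  signs al b s = signs al' b' s.
Proof. by move=> sq ea eb; apply/eq_in_map => x /sq xq; rewrite ea ?eb. Qed.

Lemma signs_cat al b s t : signs al b (s ++ t) = signs al b s ++ signs al b t.
Proof. exact: map_cat. Qed.

Lemma constant_signs al b s v : s != [::] ->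
  (forall x, x \in s -> (e x b < e x al)%N = v) ->
  exists n, signs al b s = nseq n.+1 v.
Proof.
move=> s0 sv; exists (size s).-1; rewrite prednK ?lt0n ?size_eq0 //.
rewrite -(size_map (fun x => e x b < e x al)%N).
by apply/all_pred1P/allP => _ /mapP[x xs ->]; rewrite /= sv.
Qed.

(** The second extension is made over [q ++ l1], so it preserves the equality on [l1]. The signs are
    false on [l1] and true on [l2]: exactly one more rise. *)
Lemma extend a b q : A a -> above d a -> B d b -> below q d ->
  {subset L d b <= q} ->
  exists a' b', [/\ [/\ A a', above d a' & B d b'],
    vals a' q = vals a q &
    exists l, L d b' = L d b ++ l /\ {in q, e^~ b' =1 e^~ b} /\
    forall al, al \in a' ->
      exists m n, signs al b' l = nseq m.+1 false ++ nseq n.+1 true].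
Proof.
move=> Aa da Bb qd Lq.
have [a1 [b1 [l1 [[Aa1 da1 Bb1 l1d] va1 vb1 LE1 [l10 l1P]]]]] :=
  extend_eq Aa da Bb qd Lq.
have q1d : below (q ++ l1) d by move=> x; rewrite mem_cat => /orP[/qd|/l1d].
have [|a2 [b2 [l2 [[Aa2 da2 Bb2 l2d] va2 vb2 LE2 [l20 l2P]]]]] :=
  extend_gt Aa1 da1 Bb1 q1d.
  by move=> x; rewrite LE1 !mem_cat => /orP[/Lq ->|->] //; rewrite orbT.
have sq : {subset q <= q ++ l1} by move=> x xq; rewrite mem_cat xq.
exists a2, b2; split=> //.
  by rewrite -va1 (vals_take a2 q l1) va2 -vals_take.
exists (l1 ++ l2); split; first by rewrite LE2 LE1 catA.
split=> [x xq /=|al ala].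
  by rewrite -(vals1 vb1) // (vals1 vb2) // sq.
have [al1 ala1 alE] := vals_mem va2 ala.
have [|n nE] := @constant_signs al b2 l2 true l20; first by move=> x /(l2P al x ala) ->.
have [|m mE] := @constant_signs al b2 l1 false l10.
  move=> x xl; rewrite alE ?mem_cat ?xl ?orbT //= (vals1 vb2) ?mem_cat ?xl ?orbT //.
  by rewrite (l1P al1 x ala1 xl) ltnn.
by exists m, n; rewrite signs_cat mE nE.
Qed.

(** Each new [b] extends the previous one. The list [q] contains all earlier traces, and replacing
    [a] by [a'] keeps the heights over [q], hence the earlier counts. *)
Lemma rising_family m : exists a q (b : nat -> T),
  [/\ A a, above d a & below q d] /\ forall k, (k <= m)%N ->
  [/\ B d (b k), {subset L d (b k) <= q} & forall al, al \in a ->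
     last true (signs al (b k) (L d (b k))) /\
     rises true (signs al (b k) (L d (b k))) =
       (rises true (signs al (b 0%N) (L d (b 0%N))) + k)%N].
Proof.
have last_ext al b' s m' n : signs al b' s = nseq m'.+1 false ++ nseq n.+1 true ->
    forall p, last p (signs al b' s) = true /\ rises p (signs al b' s) = 1%N.
  by move=> -> p; rewrite last_cat last_nseq rises_cat !rises_nseq last_nseq andbF.
elim: m => [|m [a [q [b [[Aa da qd] bP]]]]].
  (* One extension at the start makes the last sign true, so that a trace appended later is counted
     from the same state for every [b k]. *)
  have [a Aa da] := A_unb d; have [b Bb] := B_unb d; have Ld := L_below (B_lt Bb).
  have [a' [b' [[Aa' da' Bb'] _ [l [LE [_ lP]]]]]] := extend Aa da Bb Ld (fun _ => id).
  exists a', (L d b'), (fun=> b'); split; first by split=> //; exact: L_below (B_lt Bb').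
  move=> k; rewrite leqn0 => /eqP ->; split=> // al /lP[m' [n /last_ext lE]].
  by rewrite addn0 LE signs_cat last_cat (lE _).1.
have [Bb Lq _] := bP m (leqnn m).
have [a' [b' [[Aa' da' Bb'] va [l [LE [vb lP]]]]]] := extend Aa da Bb qd Lq.
have old k al : (k <= m)%N -> al \in a' -> exists2 al1, al1 \in a &
    signs al (b k) (L d (b k)) = signs al1 (b k) (L d (b k)).
  move=> km ala; have [al1 ala1 alE] := vals_mem va ala; exists al1 => //.
  by have [_ Lk _] := bP k km; apply: eq_signs Lk alE _.
have rise k al : (k <= m)%N -> al \in a' ->
    last true (signs al (b k) (L d (b k))) /\
    rises true (signs al (b k) (L d (b k))) =
      (rises true (signs al (b 0%N) (L d (b 0%N))) + k)%N.
  move=> km ala; have [al1 ala1 alE] := vals_mem va ala.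
  have [_ Lk /(_ _ ala1)] := bP k km; have [_ L0 _] := bP 0%N (leq0n m).
  by rewrite !(eq_signs _ alE (fun _ _ => erefl)).
exists a', (q ++ L d b'), (fun k => if k == m.+1 then b' else b k); split.
  split=> // x; rewrite mem_cat => /orP[/qd //|]; exact: L_below (B_lt Bb') _.
move=> k; rewrite leq_eqVlt => /orP[/eqP ->|km].
  rewrite eqxx; split=> // [x xL|al ala]; first by rewrite mem_cat xL orbT.
  have [m' [n /last_ext lE]] := lP al ala.
  have [_] := rise m al (leqnn m) ala.
  rewrite LE signs_cat last_cat rises_cat (lE _).1 (lE _).2 => rE; split=> //.
  by rewrite (eq_signs Lq (fun _ _ => erefl) vb) rE /= addn1 addnS.
have [Bk Lk _] := bP k km; rewrite ltn_eqF //; split=> //.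
  by move=> x /Lk; rewrite mem_cat => ->.
by move=> al ala; exact: rise.
Qed.

End Closed.

Theorem moore_oscillation m N : exists a y (b : nat -> T),
  [/\ A a, below a y & forall k, (k <= m)%N -> B y (b k) /\
    forall al, al \in a -> [/\ (N < e al (b k))%N, e al (b k) = e al (b 0%N) &
      osc al (b k) = (osc al (b 0%N) + k)%N]].
Proof.
have [d dP] := ex_reflects moore_formulas.
have [a [q [b [[Aa da qd] bP]]]] := rising_family dP m.
(* From some [c < d] up to [d], all [b k] have the same heights, and these exceed [N]. *)
have : finite_set (\bigcup_(k in `I_m.+1)
    ([set x | [/\ x < b k, x < b 0%N & e x (b k) != e x (b 0%N)]] `|`
     [set x | x < b k /\ (e x (b k) <= N)%N]))%classic.
  apply: bigcup_finite; first exact: finite_II.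
  by move=> k _; rewrite finite_setU; split; [exact: ht_coherent|exact: finite_ht_le].
move=> /(closed_avoid dP qd)[c [cd cc qc cS]].
have cP k x : (k <= m)%N -> c <= x -> x < d ->
    (N < e x (b k))%N /\ e x (b k) = e x (b 0%N).
  move=> km cx xd; have [/B_lt dbk _ _] := bP k km.
  have [/B_lt db0 _ _] := bP 0%N (leq0n m).
  have xk : x < b k by exact: lt_trans dbk.
  have x0 : x < b 0%N by exact: lt_trans db0.
  split.
    by rewrite ltnNge; apply/negP => eN; apply: (cS x cx xd); exists k => //; right.
  apply/eqP; case: (boolP (e x (b k) == e x (b 0%N))) => // ne.
  by case: (cS x cx xd); exists k => //; left.
have [||y yd [a' [Aa' va /= ca a'y]]] := dP 2%N (vals a q) [:: q; [:: c]].
- move=> t x; rewrite !inE => /orP[/eqP ->|/eqP ->]; [exact: qd|].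
  by rewrite inE => /eqP ->.
- have [z zP] := finite_bounded hT a; exists z, a; split=> //=.
  exact: above_le (ltW cd) da.
exists a', y, b; split=> // k km; have [Bk _ _] := bP k km.
split=> [|al ala]; first exact: B_mono (ltW yd) Bk.
have cal := ca al ala; have ald := lt_trans (a'y al ala) yd.
have al0 : \bot < al by apply: le_lt_trans cal; exact: le0x.
have [Nk Ek] := cP k al km (ltW cal) ald; split=> //.
have LE k' : (k' <= m)%N -> L al (b k') = L d (b k') ++ L al d.
  move=> km'; have [/B_lt/ltW Bk' Lk' _] := bP k' km'.
  apply: ltrace_cat => // [|x /Lk'/qc xc|x z /Lk'/qc xc zL]; first exact: ltW.
    exact: lt_trans cal.
  by apply: lt_le_trans xc _; exact: ltrace_ge zL.
have [al1 ala1 alE] := vals_mem va ala.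
(* Over [L d (b k')] the signs are those of [al1] and end with true; over [L al d], which lies above
   or at [c], they do not depend on [k']. *)
have main k' : (k' <= m)%N -> osc al (b k') =
    (rises true (signs al1 (b 0%N) (L d (b 0%N))) + k' +
     rises true (signs al (b 0%N) (L al d)))%N.
  move=> km'; have [_ Lk' /(_ _ ala1)[lt rE]] := bP k' km'.
  rewrite /osc LE // signs_cat rises_cat (eq_signs Lk' alE (fun _ _ => erefl)) lt rE.
  congr (_ + rises _ _)%N; apply/eq_in_map => x xL.
  have [||_ -> //] := cP k' x km'; first exact: ltrace_ge xL.
  exact: lt_trans (ltrace_lt i_inj al0 (ltW ald) xL) ald.
by rewrite !main // addn0 addnAC.
Qed.

End Oscillation.

(** * The colouring and its values on two unbounded families *)

Lemma exists_logn2 t h : exists2 k, (k <= 2 ^ h.+1)%N & logn 2 (t + k) = h.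
Proof.
have pos : (0 < 2 ^ h)%N by rewrite expn_gt0.
(* With this [q], [2 ^ h * q.*2.+1] is the least odd multiple of [2 ^ h] that is at least [t]. *)
pose q := (t + 2 ^ h).-1 %/ 2 ^ h.+1.
have lo : (q * 2 ^ h.+1 <= (t + 2 ^ h).-1)%N by exact: leq_trunc_div.
have hi : ((t + 2 ^ h).-1 < q.+1 * 2 ^ h.+1)%N by rewrite ltn_ceil // expn_gt0.
exists (2 ^ h * q.*2.+1 - t)%N.
  rewrite expnS in lo hi *; lia.
rewrite subnKC; last by rewrite expnS in lo hi; lia.
rewrite lognM // pfactorK // -[RHS]addn0; congr (_ + _)%N.
by apply/eqP; rewrite -leqn0 leqNgt -pfactor_dvdn //= ?expn1 dvdn2 /= odd_double.
Qed.

Section Colouring.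
Variables (disp : Order.disp_t) (T : bOrderType disp) (hT : is_omega1 T).
Variable i : T -> T -> nat.
Hypothesis i_inj : forall b x y, x < b -> y < b -> i b x = i b y -> x = y.

Let e := ht hT i.

(** Ties in height go to the largest element, so [z] determines [al] and [b], and then [x] by
    injectivity of [i b]. *)
Definition selects (z : {fset T}) (x : T) := exists al b,
  [/\ b \in z /\ (forall y, y \in z -> y <= b), al \in z /\ al < b,
      forall y, y \in z -> y < b -> (e y b <= e al b)%N /\ (e y b = e al b -> y <= al),
      x < b & i b x = logn 2 (osc hT i al b)].

Definition colour (z : {fset T}) : T := xget \bot (selects z)%classic.

Lemma colour_eq z x : selects z x -> colour z = x.
Proof.
move=> zx; apply: xget_unique => // y.
case: zx => al [b [[bz bM] [az ab] aM xb ix]].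
case=> al' [b' [[bz' bM'] [az' ab'] aM' yb iy]].
have bE : b' = b by apply: le_anti; rewrite bM // bM'.
subst b'; have [h1 h2] := aM _ az' ab'; have [h3 h4] := aM' _ az ab.
have eE : e al b = e al' b by apply/eqP; rewrite eqn_leq h1 h3.
have aE : al' = al by apply: le_anti; rewrite h2 // h4.
by apply: (i_inj yb xb); rewrite iy ix aE.
Qed.

Lemma ex_argmax (f : T -> nat) (a : seq T) : a != [::] ->
  exists2 al, al \in a &
    forall y, y \in a -> (f y <= f al)%N /\ (f y = f al -> y <= al).
Proof.
elim: a => // x a IH _; have [->|a0] := eqVneq a [::].
  by exists x; rewrite ?mem_head // => y; rewrite inE => /eqP ->.
have [al ala alP] := IH a0.
have [xal|alx] := boolP ((f x < f al)%N || ((f x == f al) && (x <= al))).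
  exists al; first by rewrite inE ala orbT.
  move=> y; rewrite inE => /orP[/eqP ->|/alP //].
  case/orP: xal => [fl|/andP[/eqP -> ->]] //.
  by split; [exact: ltnW|move=> fE; rewrite fE ltnn in fl].
exists x; first exact: mem_head.
move: alx; rewrite negb_or -leqNgt negb_and => /andP[fx nx] y; rewrite inE.
move=> /orP[/eqP -> //|/alP[fy yal]]; split; first exact: leq_trans fx.
move=> fE; have fE' : f x = f al by apply/eqP; rewrite eqn_leq fx -fE fy.
move: nx; rewrite fE' eqxx /= -ltNge => /ltW; apply: le_trans; apply: yal.
by rewrite fE.
Qed.

Variables (F G : seq T -> Prop).
Hypothesis F_unb : forall y, exists2 a, F a & above y a.
Hypothesis G_unb : forall y, exists2 a, G a & above y a.
Hypothesis F_neq0 : forall a, F a -> a != [::].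
Hypothesis G_neq0 : forall a, G a -> a != [::].

Lemma colour_two_families (r : seq T) (x : T) : exists a b,
  [/\ F a, G b, forall u v, u \in a -> v \in b -> u < v,
      forall u v, u \in r -> v \in a ++ b -> u < v &
      forall z : {fset T}, {subset a ++ b <= z} -> {subset z <= r ++ a ++ b} ->
        colour z = x].
Proof.
have [s sP] := finite_bounded hT (x :: r).
have sx : x < s by apply: sP; exact: mem_head.
have sr u : u \in r -> u < s by move=> ur; apply: sP; rewrite inE ur orbT.
pose P b y be h := [/\ G b, above (Order.max s y) b, be \in b,
  forall u, u \in b -> u <= be & i be x = h].
pose Q b be n := forall u, u \in r ++ b -> u < be -> (e u be <= n)%N.
have maxy y y' : y <= y' -> Order.max s y <= Order.max s y'.
  by move=> yy; rewrite ge_max !le_max lexx yy orbT.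
have [h hP] : exists h, forall y, exists b be, P b y be h.
  apply: (omega1_pigeonhole hT (P := fun h y => exists b be, P b y be h)).
    move=> y; have [b Gb sb] := G_unb (Order.max s y).
    (* For a constant function the tie-break yields the maximum. *)
    have [be beb beP] := ex_argmax (fun=> 0%N) (G_neq0 Gb).
    by exists (i be x), b, be; split=> // u /beP[_]; apply.
  move=> h y y' yy [b [be [Gb sb beb bM ix]]]; exists b, be; split=> //.
  exact: above_le (maxy _ _ yy) sb.
have [N NP] : exists N, forall y, exists b be, P b y be h /\ Q b be N.
  apply: (omega1_pigeonhole hT (P := fun N y => exists b be, P b y be h /\ Q b be N)).
    move=> y; have [b [be bP]] := hP y.
    exists (\max_(u <- r ++ b) e u be)%N, b, be; split=> // u ub _.
    exact: leq_bigmax_seq.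
  move=> n y y' yy [b [be [[Gb sb beb bM ix] bQ]]]; exists b, be; split=> //; split=> //.
  exact: above_le (maxy _ _ yy) sb.
(* Members of [G] enter through their maxima [be]; the relation at [y] retains a whole member above
   [y]. The bound [2 ^ h.+1] leaves room for every residue in [exists_logn2]. *)
have [||||a [y [b [[Fa sa] ay bP]]]] := @moore_oscillation _ _ hT i i_inj
  (fun a => F a /\ above s a) (fun y be => exists b, P b y be h /\ Q b be N)
  _ _ _ _ (2 ^ h.+1) N.
- by move=> y; have [a Fa /above_le ya] := F_unb (Order.max s y); exists a;
    [split=> //; apply: ya|apply: ya]; rewrite le_max lexx ?orbT.
- by move=> y; have [b [be bP]] := NP y; exists be, b.
- move=> y y' be yy [b [[Gb sb beb bM ix] bQ]]; exists b; split=> //; split=> //.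
  exact: above_le (maxy _ _ yy) sb.
- move=> y be [b [[Gb sb beb _ _] _]]; apply: le_lt_trans (sb _ beb).
  by rewrite le_max lexx orbT.
(* [al] can be chosen before [k], since on [a] the heights over [b k] equal those over [b 0]. *)
have [al ala alM] := ex_argmax (e^~ (b 0%N)) (F_neq0 Fa).
have [k km kh] := exists_logn2 (osc hT i al (b 0%N)) h.
have [[c [[Gc sc bc cM ix] cQ]] akP] := bP k km.
have yc v : v \in c -> y < v.
  by move=> /sc; apply: le_lt_trans; rewrite le_max lexx orbT.
have scl v : v \in c -> s < v.
  by move=> /sc; apply: le_lt_trans; rewrite le_max lexx.
exists a, c; split=> //.
- by move=> u v /ay uy /yc; exact: lt_trans.
- by move=> u v /sr us; rewrite mem_cat => /orP[/sa|/scl]; exact: lt_trans.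
move=> z acz zrac; apply: colour_eq; exists al, (b k).
have aly : al < b k := lt_trans (ay _ ala) (yc _ bc).
have [alN alE alO] := akP al ala.
split.
- split; first by rewrite acz // mem_cat bc orbT.
  move=> u /zrac; rewrite !mem_cat => /or3P[/sr us|/ay uy|/cM //]; apply: ltW.
    exact: lt_trans us (scl _ bc).
  exact: lt_trans uy (yc _ bc).
- by rewrite acz // mem_cat ala.
(* Elements of [r] and [c] below [b k] have height at most [N], so only [a] competes with [al]. *)
- move=> u uz ub; have := zrac u uz; rewrite mem_cat mem_cat orbCA => /orP[ua|].
    have [uN uE _] := akP u ua; rewrite /e uE alE; exact: alM.
  rewrite -mem_cat => /cQ /(_ ub) uN; have ul := leq_ltn_trans uN alN.
  by split; [exact: ltnW|move=> uE; move: ul; rewrite -/(e al (b k)) uE ltnn].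
- exact: lt_trans sx (scl _ bc).
- by rewrite ix alO kh.
Qed.

End Colouring.

(** * Roots of uncountable families of finite sets *)

Section DeltaSystem.
Variables (disp : Order.disp_t) (T : bOrderType disp) (hT : is_omega1 T).

Definition delta_root (X : set {fset T}) (r : {fset T}) := forall y : T,
  exists x, [/\ X x, (x `\` r != fset0)%fset & above y (x `\` r)%fset].

Lemma countable_le (y : T) : countable [set x | x <= y]%classic.
Proof.
have [_ cseg _] := hT; have [z yz] := omega1_no_max hT y.
apply: sub_countable (cseg z); apply: subset_card_le => x /= xy.
exact: le_lt_trans yz.
Qed.

(** Fix the cardinality and induct on it. A point lying in uncountably many members is removed from
    them and put into the root. *)
Lemma uncountable_delta_root (X : set {fset T}) : ~ countable X ->
  exists r, delta_root X r.
Proof.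
move=> ncX.
have [k nck] : exists k, ~ countable [set x | X x /\ #|` x| = k]%classic.
  apply: contrapT => nk; apply: ncX.
  have -> : X = (\bigcup_(k in [set: nat]) [set x | X x /\ #|` x| = k])%classic.
    apply/seteqP; split=> [x Xx|x [k _ []//]].
    by exists #|` x|.
  apply: bigcup_countable => // k _; apply: contrapT => nc.
  by apply: nk; exists k.
suff [r rP] : exists r, delta_root [set x | X x /\ #|` x| = k]%classic r.
  by exists r => y; have [x [[Xx _] *]] := rP y; exists x.
move: nck; set Y := [set x | _]%classic => nck.
have Yk x : Y x -> #|` x| = k by case.
move: Y Yk nck; clear -hT; elim: k => [|k IH] X Xk ncX.
  case: ncX; apply: sub_countable (countable1 fset0); apply: subset_card_le.
  by move=> x /Xk/cardfs0_eq ->.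
have [[xi ncxi]|cxi] := pselect (exists xi,
    ~ countable [set x | X x /\ xi \in x]%classic).
  pose Y := [set x `\ xi | x in [set x | X x /\ xi \in x]]%fset%classic.
  have [||r rP] := IH Y.
  - move=> _ [x [Xx xix] <-]; apply/eqP.
    by rewrite -eqSS -(Xk x Xx) (cardfsD1 xi x) xix.
  - move=> cY; apply: ncxi.
    apply: sub_countable (sub_countable (card_image_le (fun x => xi |` x)%fset Y) cY).
    apply: subset_card_le => x [Xx xix]; exists (x `\ xi)%fset; last exact: fsetD1K.
    by exists x.
  exists (xi |` r)%fset => y; have [_ [[x [Xx xix] <-] /fset0Pn[u ur] ry]] := rP y.
  have sub : ((x `\ xi) `\` r = x `\` (xi |` r))%fset by rewrite fsetDDl.
  exists x; split=> //.
  - by rewrite -sub; apply/fset0Pn; exists u.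
  - by rewrite -sub.
(* Here each point lies in countably many members, so only countably many members have a point at
   most [y]. *)
exists fset0 => y; apply: contrapT => nx; apply: ncX.
apply: (@sub_countable _ _ _ (\bigcup_(u in [set u | (u <= y)%O])
  [set x | X x /\ u \in x])%classic).
  apply: subset_card_le => x Xx; apply: contrapT => nux; apply: nx; exists x.
  rewrite fsetD0; split=> //; first by rewrite -cardfs_gt0 Xk.
  move=> u ux; rewrite ltNge; apply/negP => uy; apply: nux; exists u => //.
apply: bigcup_countable; first exact: countable_le.
by move=> u _; apply: contrapT => nc; apply: cxi; exists u.
Qed.

End DeltaSystem.

(** * Finite sets with increasing petals above all roots *)

Section Sunflower.
Variables (disp : Order.disp_t) (T : bOrderType disp) (n : nat).
Variables (x r : 'I_n -> {fset T}).

Let D k := (x k `\` r k)%fset.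

Hypothesis D_neq0 : forall k, D k != fset0.
Hypothesis D_lt : forall (j k : 'I_n) u v, (j < k)%N -> u \in D j -> v \in D k -> u < v.
Hypothesis r_lt : forall j k u v, u \in r j -> v \in D k -> u < v.
Hypothesis D_gt0 : forall k v, v \in D k -> \bot < v.

Lemma mem_petal k u : u \in x k -> u \in r k \/ u \in D k.
Proof. by move=> ux; rewrite in_fsetD ux andbT; case: (u \in r k); [left|right]. Qed.

Lemma petal_sup_lt (j k : 'I_n) : (j < k)%N -> fsup (x j) < fsup (x k).
Proof.
move=> jk; have /fset0Pn[v vD] := D_neq0 k.
apply: (@lt_le_trans _ _ v); last first.
  by apply: joins_sup_seq => //; move: vD; rewrite in_fsetD => /andP[].
rewrite /fsup big_seq; elim/big_ind: _ => [|u w uv wv|u /mem_petal[ur|uD]].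
- exact: D_gt0 vD.
- by rewrite ltUx uv.
- exact: r_lt ur vD.
- exact: D_lt jk uD vD.
Qed.

(** The petal [D k] misses every other [x j], whose root lies below it and whose petal lies entirely
    on one side of it; thus the lower bound for [z] contains all petals. *)
Lemma petal_cover (z : {fset T}) :
  (\bigcup_(k in 'I_n) (x k `\` \bigcup_(j in 'I_n | j != k) x j) `<=` z)%fset ->
  (z `<=` \bigcup_(k in 'I_n) x k)%fset ->
  (forall k, {subset D k <= z}) /\
  forall u, u \in z -> exists k, u \in r k \/ u \in D k.
Proof.
move=> /fsubsetP lo /fsubsetP hi; split.
  move=> k u uD; apply: lo; apply/bigfcupP; exists k; first by rewrite mem_index_enum.
  move: (uD); rewrite !in_fsetD => /andP[_ ->]; rewrite andbT.
  apply/bigfcupP => -[j /andP[_ jk] /mem_petal[/r_lt /(_ uD)|uDj]].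
    by rewrite ltxx.
  move: jk; rewrite -val_eqE /= neq_ltn => /orP[] jk.
    by have := D_lt jk uDj uD; rewrite ltxx.
  by have := D_lt jk uD uDj; rewrite ltxx.
by move=> u /hi/bigfcupP[k _ /mem_petal h]; exists k.
Qed.

End Sunflower.

(** * Choosing the petals and applying the colouring *)

Lemma increasing_petals (disp : Order.disp_t) (T : bOrderType disp)
  (X : nat -> set {fset T}) (r : nat -> {fset T}) (y : T) :
  (forall k, delta_root (X k) (r k)) ->
  exists x : nat -> {fset T}, forall k,
    [/\ X k (x k), (x k `\` r k != fset0)%fset,
        above y (x k `\` r k)%fset &
        forall j u v, (j < k)%N ->
          u \in (x j `\` r j)%fset -> v \in (x k `\` r k)%fset -> u < v].
Proof.
move=> rP.
have /choice[f fP] : forall p : nat * T, exists x,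
    [/\ X p.1 x, (x `\` r p.1 != fset0)%fset & above p.2 (x `\` r p.1)%fset].
  by move=> p; exact: rP.
pose st := fix st k :=
  if k is k'.+1 then Order.max (st k') (fsup (f (k', st k'))) else y.
exists (fun k => f (k, st k)) => k; have [Xk nk ak] := fP (k, st k).
have st_mono : {homo st : m p / (m <= p)%N >-> m <= p}.
  apply: homo_leq => //; first exact: le_trans.
  by move=> m /=; rewrite le_max lexx.
split=> //; first by apply: above_le ak; exact: (st_mono 0%N).
move=> j u v jk uj /ak; apply: le_lt_trans; apply: le_trans (st_mono _ _ jk).
rewrite /= le_max; apply/orP; right; apply: joins_sup_seq => //.
by move: uj; rewrite in_fsetD => /andP[].
Qed.

Theorem theorem3p6 (disp : Order.disp_t) (T : bOrderType disp)
  (hT : is_omega1 T) : circledast_star T.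
Proof.
have [i i_inj] := omega1_index hT.
exists (colour hT i) => -[|[|n]] X delta // _ ncX.
have /choice[r rP] : forall k, exists r, delta_root (X k) r.
  by move=> k; exact: (uncountable_delta_root hT).
pose D (x : 'I_n.+2 -> {fset T}) k := (x k `\` r k)%fset.
(* Adding [\bot] makes all petals positive, as the comparison with the supremum of an empty set
   requires. *)
pose R := \bot :: flatten [seq enum_fset (r k) | k <- enum 'I_n.+2].
have rR k u : u \in r k -> u \in R.
  move=> ur; rewrite inE; apply/orP; right; apply/flattenP.
  by exists (enum_fset (r k)) => //; apply: map_f; rewrite mem_enum.
pose ok (x : 'I_n.+2 -> {fset T}) k :=
  X k (x k) /\ D x k != fset0.
pose F a := exists x, ok x ord0 /\ a = enum_fset (D x ord0).
pose tl : seq 'I_n.+2 := [seq k <- enum 'I_n.+2 | k != ord0].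
pose G b := exists x, [/\ forall k, ok x k,
  forall (j k : 'I_n.+2) u v, (j < k)%N -> u \in D x j -> v \in D x k -> u < v &
  b = flatten [seq enum_fset (D x k) | k <- tl]].
have chain y : exists x, [/\ forall k, ok x k, forall k, above y (D x k) &
    forall (j k : 'I_n.+2) u v, (j < k)%N -> u \in D x j -> v \in D x k -> u < v].
  have [x xP] := increasing_petals (X := fun k => X (inord k))
    (r := fun k => r (inord k)) y (fun k => rP (inord k)).
  exists (fun k => x k); split=> [k|k|j k u v jk].
  - by have := xP k; rewrite inord_val => -[].
  - by have := xP k; rewrite inord_val => -[].
  - by have [_ _ _] := xP k; move=> /(_ j u v jk); rewrite /D !inord_val.
have [||||a [b [[x0 [[X0 n0] aE]] [x [xok xlt bE]] ab Rab col]]] :=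
    colour_two_families hT i_inj (F := F) (G := G) _ _ _ _ R delta.
- move=> y; have [x [xok xy _]] := chain y.
  by exists (enum_fset (D x ord0)); [exists x|exact: xy].
- move=> y; have [x [xok xy xlt]] := chain y.
  exists (flatten [seq enum_fset (D x k) | k <- tl]); first by exists x.
  by move=> u /flattenP[_ /mapP[k _ ->]]; exact: xy.
- move=> _ [x [[_ n0] ->]]; apply: contraNN n0 => /eqP n0.
  by apply/eqP/fsetP => u; rewrite -[u \in _]/(u \in enum_fset _) n0.
- move=> _ [x [xok _ ->]]; have [_ /fset0Pn[u uD]] := xok ord_max.
  apply/eqP => n0; suff : u \in flatten [seq enum_fset (D x k) | k <- tl] by rewrite n0.
  apply/flattenP; exists (enum_fset (D x ord_max)) => //; apply: map_f.
  by rewrite mem_filter mem_enum.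
have memb k u : k != ord0 -> u \in D x k -> u \in b.
  move=> k0 uD; rewrite bE; apply/flattenP; exists (enum_fset (D x k)) => //.
  by apply: map_f; rewrite mem_filter k0 mem_enum.
(* The choice behind [b] also has an entry at [ord0]; it is replaced by the one behind [a]. *)
pose w k := if k == ord0 then x0 k else x k.
have Dw k u : u \in D w k -> u \in if k == ord0 then a else b.
  by rewrite /D /w; case: eqP => [->|/eqP k0]; [rewrite aE|exact: memb].
have Dw0 k : D w k = if k == ord0 then D x0 ord0 else D x k.
  by rewrite /D /w; case: eqP => [->|].
have Dwab k u : u \in D w k -> u \in a ++ b.
  by move=> /Dw; rewrite mem_cat; case: ifP => _ ->; rewrite ?orbT.
have w_neq0 k : D w k != fset0.
  by rewrite Dw0; case: ifP => _ //; case: (xok k).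
have w_lt (j k : 'I_n.+2) u v : (j < k)%N -> u \in D w j -> v \in D w k -> u < v.
  move=> jk uj vk; have k0 : k != ord0.
    by apply/eqP => k0; rewrite k0 in jk.
  have := Dw _ _ vk; rewrite (negbTE k0); have := Dw _ _ uj.
  case: eqP => [_ ua vb|/eqP j0 _ _]; first exact: ab.
  by move: uj vk; rewrite !Dw0 (negbTE j0) (negbTE k0); exact: xlt.
have w_r j k u v : u \in r j -> v \in D w k -> u < v.
  by move=> /rR uR /Dwab; exact: Rab.
have w_gt0 k v : v \in D w k -> \bot < v.
  by move=> /Dwab; apply: Rab; rewrite mem_head.
exists w; split.
- by move=> k; rewrite /w; case: eqP => [->//|_]; case: (xok k).
- by move=> j k; exact: (petal_sup_lt w_neq0 w_lt w_r w_gt0).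
move=> z lo hi; have [zlo zhi] := petal_cover w_lt w_r lo hi.
apply: col => u.
  rewrite mem_cat => /orP[ua|].
    by apply: (zlo ord0); rewrite -/(D w ord0) Dw0 eqxx; rewrite aE in ua.
  rewrite bE => /flattenP[t /mapP[k]]; rewrite mem_filter => /andP[k0 _] -> uD.
  by apply: (zlo k); rewrite -/(D w k) Dw0 (negbTE k0).
move=> /zhi[k [/rR uR|/Dwab uab]]; rewrite mem_cat; first by rewrite uR.
by rewrite uab orbT.
Qed.
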